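(* Let $k\ge 2$ be an integer and $\varepsilon>0$. There exist constants $c=c(k,\varepsilon)>0$ and $n_0=n_0(k,\varepsilon)$ such that every graph $G$ on $n\ge n_0$ vertices with \[ q(G)\ge \left(1-\frac{1}{k}+\varepsilon\right)2n \] contains at least $c\,n^{k+1}$ copies of the complete graph $K_{k+1}$.
   Context: All graphs are finite, simple and undirected. For a graph $G$, $D(G)$ is the diagonal matrix of vertex degrees and $A(G)$ is the adjacency matrix; the signless Laplacian is $Q(G)=D(G)+A(G)$, and $q(G)$ denotes the largest eigenvalue of $Q(G)$ (the signless Laplacian spectral radius). $K_{k+1}$ is the complete graph on $k+1$ vertices; a copy of $K_{k+1}$ in $G$ is a set of $k+1$ pairwise adjacent vertices. *)

(* Defs.v *)
From HB Require Import structures.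
From mathcomp Require Import all_boot all_order all_algebra.
From mathcomp Require Import reals.
Set Implicit Arguments. Unset Strict Implicit. Unset Printing Implicit Defensive.
Import Order.TTheory GRing.Theory Num.Theory.
Local Open Scope ring_scope.

Definition simple_graph (n : nat) (e : rel 'I_n) : Prop :=
  symmetric e /\ irreflexive e.

Definition deg (n : nat) (e : rel 'I_n) (v : 'I_n) : nat := #|[set w | e v w]|.

Definition adj_mx (R : nzRingType) (n : nat) (e : rel 'I_n) : 'M[R]_n :=
  \matrix_(i, j) (e i j)%:R.

Definition deg_mx (R : nzRingType) (n : nat) (e : rel 'I_n) : 'M[R]_n :=
  \matrix_(i, j) (if i == j then (deg e i)%:R else 0).

Definition signless_laplacian (R : nzRingType) (n : nat) (e : rel 'I_n) : 'M[R]_n :=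
  deg_mx R e + adj_mx R e.

Definition is_q (R : realType) (n : nat) (e : rel 'I_n) (mu : R) : Prop :=
  eigenvalue (signless_laplacian R e) mu /\
  forall nu : R, eigenvalue (signless_laplacian R e) nu -> nu <= mu.

Definition is_clique (n : nat) (e : rel 'I_n) (S : {set 'I_n}) : bool :=
  [forall x in S, forall y in S, (x != y) ==> e x y].

Definition num_cliques (n : nat) (e : rel 'I_n) (m : nat) : nat :=
  #|[set S : {set 'I_n} | (#|S| == m) && is_clique e S]|.

(* Main.v *)
(* An eigenvector x for an eigenvalue q >= (1 + 2 eps) n is delocalized: scaled to mean 1,
   y = |x| has entries at most 1 / (2 eps). The sum of (y_i + y_j)^2 over the edges is at least
   q sum y_i^2. A graph with few copies of K_{k+1} admits, up to an error o(n^2), a Zykov-type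
   symmetrization into a complete multipartite graph with at most k parts and y constant on each
   part, which does not decrease this sum minus 2 (1 - 1/k) n sum y_i^2. For such a multipartite
   graph the difference is at most 0 by Cauchy-Schwarz, contradicting q >= (1 - 1/k + eps) 2n.
   The symmetrization error is controlled because y is bounded. *)
Require Import Defs.
From HB Require Import structures.
From mathcomp Require Import all_boot all_order all_algebra.
From mathcomp Require Import reals ring lra.
Set Implicit Arguments.
Unset Strict Implicit.
Unset Printing Implicit Defensive.
Import Order.TTheory GRing.Theory Num.Theory.
Local Open Scope ring_scope.

(** * Cliques counted as ordered tuples *)

Section CliqueCount.
Context {n : nat} (e : rel 'I_n).

Definition nbhd (v : 'I_n) : {set 'I_n} := [set w | e v w].

Definition cliques_in (m : nat) (V : {set 'I_n}) : {set {set 'I_n}} :=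
  [set S : {set 'I_n} | [&& S \subset V, #|S| == m & is_clique e S]].

(** Recursion into [V :&: nbhd v] matches the symmetrization, which passes to the neighbourhood of
    one vertex. *)
Fixpoint ordered_cliques (m : nat) (V : {set 'I_n}) : nat :=
  if m is m'.+1 then (\sum_(v in V) ordered_cliques m' (V :&: nbhd v))%N
  else 1%N.

Lemma is_cliqueP (S : {set 'I_n}) :
  reflect {in S &, forall x y, x != y -> e x y} (is_clique e S).
Proof.
apply: (iffP forall_inP) => [h x y xS yS nxy|h x xS].
  by have /forall_inP/(_ y yS)/implyP := h x xS; apply.
by apply/forall_inP => y yS; apply/implyP; apply: h.
Qed.

Hypotheses (e_sym : symmetric e) (e_irr : irreflexive e).

(** Adding [v] is a bijection from the cliques in its neighbourhood; irreflexivity keeps [v] out of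
    [nbhd v], hence injectivity. *)
Lemma card_cliques_through (m : nat) (V : {set 'I_n}) (v : 'I_n) : v \in V ->
  #|[set S in cliques_in m.+1 V | v \in S]| = #|cliques_in m (V :&: nbhd v)|.
Proof.
move=> vV; have vN (S : {set 'I_n}) : S \subset V :&: nbhd v -> v \notin S.
  by move=> sub; apply/negP => /(subsetP sub); rewrite !inE e_irr andbF.
rewrite -[RHS](@card_in_imset _ _ (fun S => v |: S)); last first.
  move=> S T /[!inE] /and3P[/vN vS _ _] /and3P[/vN vT _ _] eqST.
  by rewrite -(setU1K vS) -(setU1K vT) eqST.
apply: eq_card => S; rewrite !inE; apply/idP/imsetP.
  move=> /andP[/and3P[sub /eqP cS /is_cliqueP cl] vS].
  exists (S :\ v); last by rewrite setD1K.
  rewrite inE; apply/and3P; split.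
  - apply/subsetP => w /[!inE] /andP[nwv wS]; rewrite (subsetP sub) //=.
    by apply: cl => //; rewrite eq_sym.
  - by have := cardsD1 v S; rewrite vS cS => -[->].
  - by apply/is_cliqueP => x y /[!inE] /andP[_ xS] /andP[_ yS]; apply: cl.
move=> [S' /[!inE] /and3P[sub /eqP cS /is_cliqueP cl] ->].
have vS' := vN _ sub; rewrite setU11 cardsU1 vS' cS eqxx andbT /=.
move: sub; rewrite subsetI => /andP[subV subN].
rewrite subUset sub1set vV subV; apply/is_cliqueP => x y.
rewrite !inE => /orP[/eqP->|xS] /orP[/eqP->|yS] nxy.
- by rewrite eqxx in nxy.
- by have := subsetP subN _ yS; rewrite inE.
- by have := subsetP subN _ xS; rewrite inE e_sym.
- exact: cl.
Qed.

Lemma ordered_cliquesE (m : nat) (V : {set 'I_n}) :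
  ordered_cliques m V = (m`! * #|cliques_in m V|)%N.
Proof.
elim: m V => [|m IH] V /=.
  rewrite mul1n (_ : cliques_in 0 V = [set set0]) ?cards1 //.
  apply/setP => S; rewrite !inE cards_eq0; apply/and3P/eqP => [[_ /eqP]//|->].
  by rewrite sub0set eqxx; split=> //; apply/is_cliqueP => x y /[!inE].
transitivity (\sum_(v in V) m`! * #|[set S in cliques_in m.+1 V | v \in S]|)%N.
  by apply: eq_bigr => v vV; rewrite IH card_cliques_through.
rewrite -big_distrr /= factS mulnAC [RHS]mulnC; congr (_ * _)%N.
under eq_bigr => v _ do rewrite -sum1dep_card.
(* Double counting: a clique of size [m.+1] appears once for each of its vertices. *)
rewrite (exchange_big_dep (mem (cliques_in m.+1 V))) /=; last first.
  by move=> v S _ /andP[].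
rewrite mulnC -sum_nat_const; apply: eq_bigr => S SC.
have /[!inE] /and3P[sub /eqP cS cl] := SC.
rewrite -{}cS sum1dep_card; apply: eq_card => v.
rewrite !inE sub eqxx cl /=.
by case: (boolP (v \in S)) => [/(subsetP sub)->|_]; rewrite ?andbF.
Qed.

Lemma ordered_cliques_setT (m : nat) :
  ordered_cliques m [set: 'I_n] = (m`! * num_cliques e m)%N.
Proof.
rewrite ordered_cliquesE; congr (_ * _)%N; apply: eq_card => S.
by rewrite !inE subsetT.
Qed.

Lemma ordered_cliquesS (m : nat) (V W : {set 'I_n}) :
  V \subset W -> (ordered_cliques m V <= ordered_cliques m W)%N.
Proof.
move=> VW; rewrite !ordered_cliquesE leq_mul2l subset_leq_card ?orbT //.
apply/subsetP => S /[!inE] /and3P[SV -> ->].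
by rewrite (subset_trans SV VW).
Qed.

End CliqueCount.

(** * Quadratic inequality for complete multipartite graphs *)

Section MultipartiteValue.
Context {R : realFieldType}.
Implicit Types (s : seq (nat * R)) (h : R -> R).

(* Parts are listed as (size, common value z); edges between two parts have value
   2 (z + z')^2 (each unordered pair is counted twice, as in [energy]). *)
Fixpoint multipartite_value s h : R :=
  if s is (a, z) :: s' then
    a%:R * h z + multipartite_value s' (fun x => h x + 2 * a%:R * (z + x) ^+ 2)
  else 0.

Definition moment s (i : nat) : R := \sum_(p <- s) p.1%:R * p.2 ^+ i.
Definition sum_sq_parts s : R := \sum_(p <- s) (p.1%:R * p.2) ^+ 2.

(** All ordered pairs of parts give twice [moment s 0 * moment s 2 + moment s 1 ^+ 2]; the diagonal
    pairs, [4 * sum_sq_parts s], are removed. *)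
Lemma multipartite_valueE s h :
  multipartite_value s h =
    \sum_(p <- s) p.1%:R * h p.2 +
    2 * (moment s 0 * moment s 2 + moment s 1 ^+ 2 - 2 * sum_sq_parts s).
Proof.
elim: s h => [|[a z] s IH] h /=.
  by rewrite /moment /sum_sq_parts !big_nil; ring.
have cons_moment i : moment ((a, z) :: s) i = a%:R * z ^+ i + moment s i.
  by rewrite /moment big_cons.
have -> : sum_sq_parts ((a, z) :: s) = (a%:R * z) ^+ 2 + sum_sq_parts s.
  by rewrite /sum_sq_parts big_cons.
rewrite {}IH !cons_moment big_cons /=.
have -> : \sum_(p <- s) p.1%:R * (h p.2 + 2 * a%:R * (z + p.2) ^+ 2) =
    \sum_(p <- s) p.1%:R * h p.2 +
    2 * a%:R * (z ^+ 2 * moment s 0 + 2 * z * moment s 1 + moment s 2).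
  rewrite /moment !big_distrr -!big_split /= big_distrr -big_split /=.
  by apply: eq_bigr => p _; ring.
by ring.
Qed.

(** Cauchy-Schwarz over the parts, by expanding squared deviations from [c]. *)
Lemma sqr_moment1_le_sum_sq_parts s (k : nat) : (0 < k)%N -> (size s <= k)%N ->
  moment s 1 ^+ 2 <= k%:R * sum_sq_parts s.
Proof.
move=> k0 sk; have k0' : 0 < k%:R :> R by rewrite ltr0n.
pose c := moment s 1 / k%:R.
have : 0 <= \sum_(p <- s) (p.1%:R * p.2 - c) ^+ 2.
  by apply: sumr_ge0 => p _; apply: sqr_ge0.
rewrite (_ : \sum_(p <- s) _ =
    sum_sq_parts s - 2 * c * moment s 1 + (size s)%:R * c ^+ 2); last first.
  rewrite /sum_sq_parts /moment -sum1_size natr_sum mulr_suml big_distrr /=.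
  rewrite -sumrB -big_split /=; apply: eq_bigr => p _; ring.
have: (size s)%:R * c ^+ 2 <= k%:R * c ^+ 2.
  by rewrite ler_wpM2r ?sqr_ge0 // ler_nat.
have -> : moment s 1 = k%:R * c by rewrite /c; field; rewrite gt_eqF.
move=> h1 h2; rewrite exprMn expr2 -mulrA ler_pM2l //; nra.
Qed.

(** Cauchy-Schwarz weighted by the part sizes. *)
Lemma sqr_moment1_le_moment2 s (n : R) : 0 < n -> moment s 0 <= n ->
  moment s 1 ^+ 2 <= n * moment s 2.
Proof.
move=> n0 sn; pose c := moment s 1 / n.
have : 0 <= \sum_(p <- s) p.1%:R * (p.2 - c) ^+ 2.
  by apply: sumr_ge0 => p _; rewrite mulr_ge0 ?sqr_ge0.
rewrite (_ : \sum_(p <- s) _ =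
    moment s 2 - 2 * c * moment s 1 + moment s 0 * c ^+ 2); last first.
  rewrite /moment mulr_suml big_distrr /=.
  by rewrite -sumrB -big_split /=; apply: eq_bigr => p _; ring.
have: moment s 0 * c ^+ 2 <= n * c ^+ 2 by rewrite ler_wpM2r ?sqr_ge0.
have -> : moment s 1 = n * c by rewrite /c; field; rewrite gt_eqF.
move=> h1 h2; rewrite exprMn expr2 -mulrA ler_pM2l //; nra.
Qed.

Lemma multipartite_value_le0 s (k : nat) (n : R) :
  (2 <= k)%N -> (size s <= k)%N -> 0 < n -> moment s 0 <= n ->
  multipartite_value s (fun z => - (4 * (1 - k%:R^-1) * n * z ^+ 2)) <= 0.
Proof.
move=> k2 sk n0 sn; have k0 : (0 < k)%N by apply: leq_trans k2.
rewrite multipartite_valueE.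
rewrite (_ : \sum_(p <- s) _ = - (4 * (1 - k%:R^-1) * n * moment s 2)); last first.
  by rewrite /moment big_distrr -sumrN; apply: eq_bigr => p _ /=; ring.
have h1 := sqr_moment1_le_sum_sq_parts k0 sk.
have h2 := sqr_moment1_le_moment2 n0 sn.
have m2 : 0 <= moment s 2 by apply: sumr_ge0 => p _; rewrite mulr_ge0 ?sqr_ge0.
have h3 : moment s 0 * moment s 2 <= n * moment s 2 by rewrite ler_wpM2r.
have k0' : 0 < k%:R :> R by rewrite ltr0n.
set j := k%:R^-1; have jk : j * k%:R = 1 by rewrite mulVf ?gt_eqF.
have h4 : j * moment s 1 ^+ 2 <= sum_sq_parts s.
  by rewrite -[leRHS]mul1r -jk -mulrA ler_wpM2l // invr_ge0 ltW.
(* After [h4], the term [moment s 1 ^+ 2] has coefficient [2 * (1 - 2 * j)]; [k >= 2] makes it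
   nonnegative, so [h2] applies. *)
have j2 : 0 <= 1 - 2 * j.
  by rewrite subr_ge0 ler_pdivrMr ?mul1r ?ler_nat.
have h5 : (1 - 2 * j) * moment s 1 ^+ 2 <= (1 - 2 * j) * (n * moment s 2).
  by rewrite ler_wpM2l.
lra.
Qed.

End MultipartiteValue.

(** * Energy of a weighted graph and its symmetrization *)

Section Energy.
Context {R : realFieldType} {n : nat} (e : rel 'I_n) (y : 'I_n -> R).
Implicit Types (V A : {set 'I_n}) (h : R -> R).

Definition edge_weight (i j : 'I_n) : R := (e i j)%:R * (y i + y j) ^+ 2.

Definition energy V h : R :=
  \sum_(i in V) \sum_(j in V) edge_weight i j + \sum_(i in V) h (y i).

(** For irreflexive [e] and [i] in [V], the energy lost by deleting [i]; the 2 accounts for both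
    orders of a pair. *)
Definition gain V h i : R := h (y i) + 2 * \sum_(j in V) edge_weight i j.

Lemma edge_weight_ge0 i j : 0 <= edge_weight i j.
Proof. by rewrite mulr_ge0 ?sqr_ge0. Qed.

Lemma energy_set0 h : energy set0 h = 0.
Proof. by rewrite /energy !big_set0 addr0. Qed.

(** The gains count pairs inside [V :\: A] twice, so the slack is a sum of nonnegative weights. *)
Lemma energy_le_gain A V h : symmetric e -> A \subset V ->
  energy V h <= energy A h + \sum_(i in V :\: A) gain V h i.
Proof.
move=> e_sym AV; have VA : V :&: A = A by apply/setIidPr.
have split (f : 'I_n -> R) :
    \sum_(i in V) f i = \sum_(i in A) f i + \sum_(i in V :\: A) f i.
  by rewrite (big_setID A) /= VA.
pose W (P Q : {set 'I_n}) : R := \sum_(i in P) \sum_(j in Q) edge_weight i j.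
have W_sym P Q : W P Q = W Q P.
  rewrite /W exchange_big /=; apply: eq_bigr => i _; apply: eq_bigr => j _.
  by rewrite /edge_weight e_sym addrC.
have W_splitl Q : W V Q = W A Q + W (V :\: A) Q by apply: split.
have W_splitr P : W P V = W P A + W P (V :\: A) by rewrite !(W_sym P) W_splitl.
have W_ge0 : 0 <= W (V :\: A) (V :\: A).
  by apply: sumr_ge0 => i _; apply: sumr_ge0 => j _; apply: edge_weight_ge0.
rewrite /energy /gain (split (h \o y)) big_split /= -big_distrr /=.
rewrite -/(W V V) -/(W A A) -/(W (V :\: A) V) W_splitl !W_splitr.
rewrite (W_sym A (V :\: A)); lra.
Qed.

Lemma gain_le (C H : R) V h i :
  (forall j, 0 <= y j <= C) -> (forall z, 0 <= z <= C -> h z <= H * n%:R) ->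
  gain V h i <= (H + 8 * C ^+ 2) * n%:R.
Proof.
move=> yC hH; have hi := hH _ (yC i).
have : \sum_(j in V) edge_weight i j <= \sum_(j < n) 4 * C ^+ 2.
  rewrite [leRHS](bigID (mem V)) /= -[leLHS]addr0 lerD //; last first.
    by apply: sumr_ge0 => j _; rewrite mulr_ge0 ?sqr_ge0.
  apply: ler_sum => j _; have /andP[yi0 yiC] := yC i.
  have /andP[yj0 yjC] := yC j.
  rewrite /edge_weight; case: (e i j); rewrite ?mul1r ?mul0r; first nra.
  by rewrite mulr_ge0 ?sqr_ge0.
rewrite sumr_const card_ord -mulr_natr /gain; lra.
Qed.

Lemma gain_nbhd V h v :
  gain V h v = h (y v) + 2 * \sum_(j in V :&: nbhd e v) (y v + y j) ^+ 2.
Proof.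
rewrite /gain; congr (_ + 2 * _).
rewrite [RHS](eq_bigl (fun j => (j \in V) && e v j)); last first.
  by move=> j; rewrite !inE.
rewrite big_mkcondr /=; apply: eq_bigr => j _.
by rewrite /edge_weight; case: (e v j); rewrite ?mul1r ?mul0r.
Qed.

End Energy.

(* Zykov-type symmetrization, robust to few cliques: delete the vertices whose
   neighbourhood contains many m-cliques; then replace all non-neighbours of a vertex v
   of maximal gain by clones of v, and absorb their contribution into h while
   treating the neighbourhood of v by induction. *)
Lemma energy_le_multipartite_value {R : realFieldType} (C : R) (m : nat) (H eta : R) :
  0 < H -> 0 < eta ->
  exists2 delta : R, 0 < delta &
    forall (n : nat) (e : rel 'I_n) (y : 'I_n -> R) (h : R -> R) (V : {set 'I_n}),
      symmetric e -> irreflexive e ->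
      (forall i, 0 <= y i <= C) ->
      (forall z, 0 <= z <= C -> h z <= H * n%:R) ->
      (ordered_cliques e m V)%:R <= delta * n%:R ^+ m ->
      exists s : seq (nat * R),
        [/\ (size s < m)%N, (\sum_(p <- s) p.1 <= #|V|)%N &
            energy e y V h <= multipartite_value s h + eta * n%:R ^+ 2].
Proof.
elim: m H eta => [|m IH] H eta H0 eta0.
  (* The only 0-tuple is counted as 1, so any [delta < 1] makes the hypothesis fail. *)
  exists (1 / 2) => [|n e y h V _ _ _ _ /=]; first lra.
  by rewrite expr0; lra.
(* [H'] bounds, per factor [n], both the gains and the next potential [h']: clones add at most
   [2 * n * (2 * C) ^+ 2]. *)
pose H' := H + 8 * C ^+ 2; have H'0 : 0 < H' by have := sqr_ge0 C; rewrite /H'; lra.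
have eta20 : 0 < eta / 2 by lra.
have [d d0 {}IH] := IH H' (eta / 2) H'0 eta20.
(* Chosen so that at most [eta / 2 * n / H'] vertices are bad; deleting each costs at most [H' * n],
   in total half the error. *)
exists (d * (eta / 2) / H') => [|n e y h V e_sym e_irr yC hH].
  by rewrite divr_gt0 // mulr_gt0.
have [n_eq0|n0] := posnP n.
  move=> _; exists [::]; split=> //; first by rewrite big_nil.
  rewrite (_ : V = set0) ?energy_set0 ?n_eq0 ?expr0n ?mulr0 ?addr0 //.
  by apply/setP => i; have := ltn_ord i; rewrite {2}n_eq0.
move=> /= few; have n0' : 0 < n%:R :> R by rewrite ltr0n.
pose bad := [set v in V | d * n%:R ^+ m < (ordered_cliques e m (V :&: nbhd e v))%:R].
have bad_sub : bad \subset V by apply/subsetP => v /[!inE] /andP[].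
have bad_card : #|bad|%:R * H' <= eta / 2 * n%:R.
  have : #|bad|%:R * (d * n%:R ^+ m) <= d * (eta / 2) / H' * n%:R ^+ m.+1.
    apply: le_trans few; rewrite natr_sum mulr_natl -sumr_const.
    rewrite [leRHS](big_setID bad) /= (setIidPr bad_sub) -[leLHS]addr0 lerD //.
      by apply: ler_sum => v /[!inE] /andP[_ /ltW].
    exact: sumr_ge0.
  rewrite exprS [leLHS]mulrCA [leRHS](_ : _ =
    d * (eta / 2 * n%:R / H' * n%:R ^+ m)); last by field; rewrite gt_eqF.
  by rewrite ler_pM2l // ler_pM2r ?exprn_gt0 // ler_pdivlMr.
pose V' := V :\: bad.
have V'V : V' \subset V by apply: subsetDl.
have energyV : energy e y V h <= energy e y V' h + eta / 2 * n%:R ^+ 2.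
  apply: le_trans (energy_le_gain _ _ e_sym V'V) _; rewrite lerD2l.
  rewrite setDDr setDv set0U (setIidPr bad_sub).
  apply: le_trans (ler_sum _ (fun i _ => gain_le e V i yC hH)) _.
  by rewrite sumr_const -[_ *+ #|_|]mulr_natl -/H' mulrA [n%:R ^+ 2]expr2 [leRHS]mulrA ler_pM2r.
have [V'0|[v0 v0V']] := set_0Vmem V'.
  exists [::]; split=> //; first by rewrite big_nil.
  move: energyV; rewrite V'0 energy_set0 /=.
  have : 0 < n%:R ^+ 2 :> R by rewrite exprn_gt0.
  nra.
case: (Order.TotalTheory.arg_maxP (gain e y V' h) v0V') => v v_in v_max.
have {v_in}vV' : v \in V' by [].
have {}v_max i : i \in V' -> gain e y V' h i <= gain e y V' h v by apply: v_max.
set A := V' :&: nbhd e v; have AV' : A \subset V' by apply: subsetIl.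
pose b := #|V' :\: A|.
pose h' x := h x + 2 * b%:R * (y v + x) ^+ 2.
have b_le : b%:R <= n%:R :> R.
  by rewrite ler_nat -[leqRHS]card_ord; apply: max_card.
have h'H z : 0 <= z <= C -> h' z <= H' * n%:R.
  move=> zC; have := hH _ zC; have /andP[y0 yC'] := yC v; have /andP[z0 zC'] := zC.
  have : b%:R * (y v + z) ^+ 2 <= n%:R * (4 * C ^+ 2).
    by rewrite ler_pM ?sqr_ge0 //; nra.
  rewrite /h' /H'; lra.
have fewA : (ordered_cliques e m A)%:R <= d * n%:R ^+ m.
  move: vV'; rewrite !inE => /andP[+ vV]; rewrite vV /= -leNgt.
  apply: le_trans; rewrite ler_nat ordered_cliquesS //.
  by rewrite setSI.
have [s [s_size s_sum s_val]] := IH n e y h' A e_sym e_irr yC h'H fewA.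
exists ((b, y v) :: s); split=> //.
  rewrite big_cons /= (leq_trans _ (subset_leq_card V'V)) //.
  by rewrite -(cardsID A V') (setIidPr AV') addnC leq_add.
have : energy e y V' h <= energy e y A h + b%:R * gain e y V' h v.
  apply: le_trans (energy_le_gain _ _ e_sym AV') _; rewrite lerD2l.
  rewrite mulr_natl -sumr_const; apply: ler_sum => i /setDP[iV' _].
  exact: v_max.
(* The edge part of the [b] gains becomes the extra term of [h'] on [A]. *)
have -> : energy e y A h + b%:R * gain e y V' h v =
    b%:R * h (y v) + energy e y A h'.
  rewrite gain_nbhd -/A /energy /h' big_split /= -big_distrr /=; ring.
rewrite /= -/h'; lra.
Qed.

(** * Quadratic form and eigenvectors of the signless Laplacian *)

Section SignlessLaplacian.
Context {R : realFieldType} {n : nat} (e : rel 'I_n).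
Hypothesis e_sym : symmetric e.

Lemma mulmx_signless_laplacian (x : 'rV[R]_n) (v : 'I_n) :
  (x *m signless_laplacian R e) 0 v =
    (deg e v)%:R * x 0 v + \sum_(w < n) (e v w)%:R * x 0 w.
Proof.
rewrite /signless_laplacian mulmxDr !mxE; congr (_ + _).
  rewrite (bigD1 v) //= mxE eqxx mulrC big1 ?addr0 // => w wv.
  by rewrite mxE (negPf wv) mulr0.
by apply: eq_bigr => w _; rewrite mxE e_sym mulrC.
Qed.

Lemma natr_deg (v : 'I_n) : (deg e v)%:R = \sum_(w < n) (e v w)%:R :> R.
Proof.
rewrite /deg -sum1dep_card natr_sum [LHS]big_mkcond /=.
by apply: eq_bigr => w _; case: (e v w).
Qed.

(** The quadratic form of [Q] sums [(y i + y j) ^+ 2] over edges; ordered pairs double it. *)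
Lemma sum_edge_weight (y : 'I_n -> R) :
  \sum_(i < n) \sum_(j < n) edge_weight e y i j =
  2 * \sum_(i < n) y i * ((deg e i)%:R * y i + \sum_(j < n) (e i j)%:R * y j).
Proof.
have -> : \sum_(i < n) \sum_(j < n) edge_weight e y i j =
    \sum_(i < n) \sum_(j < n) (e i j)%:R * (y i ^+ 2 + y i * y j) +
    \sum_(i < n) \sum_(j < n) (e i j)%:R * (y j ^+ 2 + y i * y j).
  rewrite -big_split; apply: eq_bigr => i _; rewrite -big_split.
  by apply: eq_bigr => j _ /=; rewrite /edge_weight; ring.
rewrite [X in _ + X]exchange_big /= [X in _ + X](_ : _ =
    \sum_(i < n) \sum_(j < n) (e i j)%:R * (y i ^+ 2 + y i * y j)); last first.
  by apply: eq_bigr => i _; apply: eq_bigr => j _; rewrite e_sym; ring.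
rewrite mulr_natl mulr2n -big_split -big_split; apply: eq_bigr => i _ /=.
suff -> : \sum_(j < n) (e i j)%:R * (y i ^+ 2 + y i * y j) =
  y i * ((deg e i)%:R * y i + \sum_(j < n) (e i j)%:R * y j) by [].
rewrite natr_deg mulr_suml -big_split big_distrr.
by apply: eq_bigr => j _ /=; ring.
Qed.

(* Since deg v <= n, the relation (q - deg v) |x_v| <= sum_w |x_w| bounds every |x_v| by
   (2 eps n)^-1 times the l1-norm. For k >= 2 the hypothesis on q(G) gives
   q >= (1 + 2 eps) n; without this, x could concentrate on few vertices (as for a star). *)
Lemma delocalized_eigenvector (q eps : R) :
  eigenvalue (signless_laplacian R e) q -> 0 < eps ->
  (1 + 2 * eps) * n%:R <= q ->
  exists y : 'I_n -> R,
    [/\ forall i, 0 <= y i <= (2 * eps)^-1, \sum_(i < n) y i = n%:R &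
        forall i, q * y i <= (deg e i)%:R * y i + \sum_(j < n) (e i j)%:R * y j].
Proof.
move=> /eigenvalueP[x xQ x0] eps0 q_ge.
have [v0 xv0] : exists v0, x 0 v0 != 0 by apply/rV0Pn.
have n0 : 0 < n%:R :> R by rewrite ltr0n (leq_ltn_trans (leq0n v0)).
pose S := \sum_(i < n) `|x 0 i|.
have S0 : 0 < S.
  by rewrite /S (bigD1 v0) //= ltr_wpDr ?normr_gt0 ?sumr_ge0.
have q0 : 0 <= q by nra.
have xq i : q * `|x 0 i| <= (deg e i)%:R * `|x 0 i| + \sum_(j < n) (e i j)%:R * `|x 0 j|.
  have := congr1 (fun u : 'rV_n => `|u 0 i|) xQ.
  rewrite mulmx_signless_laplacian mxE normrM (ger0_norm q0) => <-.
  apply: le_trans (ler_normD _ _) _; rewrite normrM ger0_norm // lerD2l.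
  apply: le_trans (ler_norm_sum _ _ _) _; apply: ler_sum => j _.
  by rewrite normrM ger0_norm.
exists (fun i => n%:R / S * `|x 0 i|); split=> [i||i].
- rewrite mulr_ge0 ?divr_ge0 ?(ltW S0) //=.
  have : \sum_(j < n) (e i j)%:R * `|x 0 j| <= S.
    by apply: ler_sum => j _; case: (e i j); rewrite ?mul1r ?mul0r.
  have deg_n : (deg e i)%:R <= n%:R :> R.
    by rewrite ler_nat -[leqRHS]card_ord; apply: max_card.
  have := xq i; have := normr_ge0 (x 0 i); set z := `|x 0 i| => z0 xqi le_S.
  have eps20 : 0 < 2 * eps by lra.
  rewrite -[leRHS]mul1r ler_pdivlMr // (_ : _ * _ = n%:R * z * (2 * eps) / S).
    by rewrite ler_pdivrMr // mul1r; nra.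
  by ring.
- by rewrite -big_distrr /= -/S divfK ?gt_eqF.
- rewrite mulrCA [in leRHS]mulrCA.
  under [X in _ + X]eq_bigr => j _ do rewrite mulrCA.
  by rewrite -big_distrr -mulrDr ler_pM2l ?divr_gt0.
Qed.

End SignlessLaplacian.

(** * Contradiction from few cliques *)

Theorem theorem2p2 (R : realType) (k : nat) (eps : R) :
  (2 <= k)%N -> 0 < eps ->
  exists (c : R) (n0 : nat), 0 < c /\
    forall (n : nat) (e : rel 'I_n) (q : R),
      (n0 <= n)%N -> simple_graph e -> is_q e q ->
      q >= (1 - k%:R^-1 + eps) * (2 * n%:R) ->
      (num_cliques e k.+1)%:R >= c * n%:R ^+ k.+1.
Proof.
move=> k2 eps0.
(* Fewer than [k.+1] parts means at most [k]. The potential used is nonpositive, so [H = 1]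
   suffices; the error [eps] is below the surplus [4 * eps]. *)
have [d d0 stability] :=
  energy_le_multipartite_value ((2 * eps)^-1) k.+1 ltr01 eps0.
have fact0 : 0 < (k.+1)`!%:R :> R by rewrite ltr0n fact_gt0.
exists (d / (k.+1)`!%:R), 1%N; split; first by rewrite divr_gt0.
move=> n e q n_gt0 [e_sym e_irr] [q_eig _] q_ge.
have n0 : 0 < n%:R :> R by rewrite ltr0n.
rewrite leNgt; apply/negP => few.
have k_inv : k%:R^-1 <= 2^-1 :> R.
  by rewrite lef_pV2 ?posrE ?ltr0n ?ler_nat // (leq_trans _ k2).
have q_n : (1 + 2 * eps) * n%:R <= q by apply: le_trans q_ge; nra.
have [y [yC y_sum y_q]] := delocalized_eigenvector e_sym q_eig eps0 q_n.
pose t : R := 4 * (1 - k%:R^-1) * n%:R.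
have few_ordered : (ordered_cliques e k.+1 [set: 'I_n])%:R <= d * n%:R ^+ k.+1.
  rewrite ordered_cliques_setT // natrM mulrC -ler_pdivlMr // mulrAC; exact: ltW.
have t0 : 0 <= t by rewrite /t; nra.
have h_le z : 0 <= z <= (2 * eps)^-1 -> - (t * z ^+ 2) <= 1 * n%:R.
  by have := sqr_ge0 z; nra.
have [s [s_size s_sum]] := stability n e y _ _ e_sym e_irr yC h_le few_ordered.
have s_n : moment s 0 <= n%:R :> R.
  rewrite /moment; under eq_bigr => p _ do rewrite expr0 mulr1.
  by rewrite -natr_sum ler_nat (leq_trans s_sum) // cardsT card_ord.
have := multipartite_value_le0 k2 s_size n0 s_n; rewrite -/t => value_le0.
pose N := \sum_(i < n) y i ^+ 2.
(* The entries have mean 1, so their mean square is at least 1. *)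
have N_ge : n%:R <= N.
  have : 0 <= \sum_(i < n) (y i - 1) ^+ 2 by apply: sumr_ge0 => i _; apply: sqr_ge0.
  have -> : \sum_(i < n) (y i - 1) ^+ 2 = N - 2 * \sum_(i < n) y i + \sum_(i < n) 1.
    by rewrite big_distrr -sumrB -big_split; apply: eq_bigr => i _ /=; ring.
  by rewrite y_sum sumr_const card_ord; lra.
have : 2 * q * N - t * N <= energy e y [set: 'I_n] (fun z => - (t * z ^+ 2)).
  rewrite /energy; under eq_bigl do rewrite inE.
  under eq_bigr => i _ do under eq_bigl do rewrite inE.
  under [X in _ <= _ + X]eq_bigl do rewrite inE.
  rewrite sumrN -big_distrr lerD2r sum_edge_weight // -mulrA ler_pM2l //.
  rewrite big_distrr; apply: ler_sum => i _ /=.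
  have := y_q i; have /andP[yi _] := yC i; nra.
have : 4 * eps * n%:R * N <= 2 * q * N - t * N.
  rewrite -mulrBl ler_wpM2r; [lra | by lra | rewrite /t; lra].
(* The energy is at least [4 * eps * n ^+ 2] but at most [eps * n ^+ 2]. *)
have : 0 < eps * n%:R ^+ 2 by rewrite mulr_gt0 ?exprn_gt0.
have : eps * n%:R * n%:R <= eps * n%:R * N by rewrite ler_pM2l ?mulr_gt0.
lra.
Qed.
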